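(* Let $\mathbb{H}$ be the set of finite MultiAspect Graphs up to MAG isomorphism, let $\mathbb{J}$ be the set of pairs (adjacency matrix, companion tuple) up to simultaneous row/column permutation, and let $\Upsilon:\mathbb{H}\to\mathbb{J}$, $H\mapsto(\mathbf{J}(H),\tau(H))$. Then for every set $\mathbb{X}$ and every function $F:\mathbb{H}\to\mathbb{X}$ there exists a function $\hat F:\mathbb{J}\to\mathbb{X}$ with $\hat F(\Upsilon(H))=F(H)$ for all $H\in\mathbb{H}$. That is, every function that can be obtained from a MAG to a given codomain can also be obtained from the matrix representation (adjacency matrix and companion tuple) of the MAG.
   Context: A MultiAspect Graph (MAG) is a pair $H=(A,E)$ where $A=(A[1],\dots,A[p])$ is a finite list of finite nonempty sets called aspects and $E$ is a set of edges, each a tuple $e=(a_1,\dots,a_p,b_1,\dots,b_p)$ with $a_i,b_i\in A[i]$, self-loops not allowed; composite vertices are elements of $\mathbb{V}(H)=A[1]\times\cdots\times A[p]$, with $\pi_o(e)=(a_1,\dots,a_p)$, $\pi_d(e)=(b_1,\dots,b_p)$. MAGs $H,K$ of order $p$ are isomorphic if there is an aspect list bijection $F$ (a family of bijections between the aspects of $H$ and those of $K$) with $e\in E(H)$ iff the edge from $F(\pi_o(e))$ to $F(\pi_d(e))$ is in $E(K)$. The companion tuple is $\tau(H)=(|A[1]|,\dots,|A[p]|)$. Indexing each aspect $A[i]$ by $\{0,\dots,\tau_i-1\}$, the numerical representation of a composite vertex is $D(\mathbf{u},\tau)=1+\sum_{i=1}^p\big(\prod_{j<i}\tau_j\big)\mathbf{u}[i]$,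 a bijection onto $\{1,\dots,n\}$ with $n=\prod_i\tau_i$. The adjacency matrix $\mathbf{J}(H)$ is the $n\times n$ $0/1$ matrix with a $1$ at $(D(\pi_o(e),\tau),D(\pi_d(e),\tau))$ for each $e\in E(H)$.
   Formalization: The row/column permutations identifying pairs in 𝕁 are restricted to those induced by relabelling each aspect separately (companion tuple fixed); with arbitrary permutations the claim fails, e.g. for τ=(2,2) with single edges (0,0)→(1,0) and (0,0)→(1,1). *)

(* Defs.v *)
From HB Require Import structures.
From mathcomp Require Import all_boot all_algebra perm boolp.

Set Implicit Arguments.
Unset Strict Implicit.
Unset Printing Implicit Defensive.

Local Open Scope nat_scope.

Notation vertices A := {dffun forall i, Finite.sort (A i)}.

(* An edge is encoded as the pair of its origin pi_o(e) and its
   destination pi_d(e). *)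
Record mag (p : nat) := Mag {
  aspect : 'I_p -> finType;
  edges : {set vertices aspect * vertices aspect};
  aspect_gt0 : forall i, 0 < #|aspect i|;
  edges_loopless : forall e, e \in edges -> e.1 != e.2
}.

Definition map_vertex p (A B : 'I_p -> finType) (F : forall i, A i -> B i)
    (u : vertices A) : vertices B :=
  [ffun i => F i (u i)].

Definition mag_iso p (H K : mag p) : Prop :=
  exists2 F : forall i, aspect H i -> aspect K i,
    forall i, bijective (F i) &
    forall u v : vertices (aspect H),
      ((u, v) \in edges H) = ((map_vertex F u, map_vertex F v) \in edges K).

Definition companion p (H : mag p) : p.-tuple nat := [tuple #|aspect H i| | i < p].

Definition nverts p (tau : p.-tuple nat) : nat := \prod_(i < p) tnth tau i.

Definition numrep p (tau : p.-tuple nat) (u : 'I_p -> nat) : nat :=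
  1 + \sum_(i < p) (\prod_(j < p | j < i) tnth tau j) * u i.

(* Each aspect A[i] is indexed by {0, ..., tau_i - 1} through enum_rank. *)
Definition coords p (A : 'I_p -> finType) (u : vertices A) : 'I_p -> nat :=
  fun i => enum_rank (u i).

(* Numerical representations start at 1 and ordinals at 0, hence x.+1. *)
Definition mag_mx p (H : mag p) : 'M[nat]_(nverts (companion H)) :=
  \matrix_(x, y)
    nat_of_bool [exists e in edges H,
      (numrep (companion H) (coords e.1) == x.+1)
      && (numrep (companion H) (coords e.2) == y.+1)].

(* The adjacency matrices with companion tuple [tagged tau]. *)
Record adjmx (tau : {p : nat & p.-tuple nat}) := AdjMx {
  amx :> 'M[nat]_(nverts (tagged tau));
  comp_gt0 : forall i, 0 < tnth (tagged tau) i;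
  amx01 : forall x y, amx x y <= 1;
  amx_diag : forall x, amx x x = 0
}.

(* The row/column permutations allowed on a pair (matrix, tau) are those
   compatible with tau, that is, obtained by relabelling each aspect
   {0, ..., tau_i - 1}.  Arbitrary permutations of the composite vertices do
   not respect the companion tuple: for tau = (2, 2) they would identify the MAG
   with single edge (0,0) -> (1,0) and the one with single edge
   (0,0) -> (1,1), which are not isomorphic. *)
Definition aspectwise p (tau : p.-tuple nat) (s : {perm 'I_(nverts tau)}) : Prop :=
  exists g : forall i, {perm 'I_(tnth tau i)},
    forall (u : forall i, 'I_(tnth tau i)) (x : 'I_(nverts tau)),
      numrep tau (fun i => u i) = x.+1 ->
      numrep tau (fun i => g i (u i)) = (s x).+1.

Definition adjmx_sim tau (M N : adjmx tau) : Prop :=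
  exists2 s : {perm 'I_(nverts (tagged tau))},
    aspectwise s & amx M = row_perm s (col_perm s N).

Definition fiberwise (I : eqType) (T : I -> Type)
    (R : forall i, T i -> T i -> Prop) (x y : {i : I & T i}) : Prop :=
  tag x = tag y /\ R (tag x) (tagged x) (tagged_as x y).

Lemma fiberwiseE (I : eqType) (T : I -> Type) (R : forall i, T i -> T i -> Prop)
    i (a b : T i) :
  fiberwise R (Tagged T a) (Tagged T b) <-> R i a b.
Proof. by rewrite /fiberwise tagged_asE; split=> [[]|]. Qed.

Definition equivalence (T : Type) (R : T -> T -> Prop) : Prop :=
  [/\ forall x, R x x, forall x y, R x y -> R y x &
      forall x y z, R x y -> R y z -> R x z].

Lemma fiberwise_equivalence (I : eqType) (T : I -> Type)
    (R : forall i, T i -> T i -> Prop) :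
  (forall i, equivalence (R i)) -> equivalence (fiberwise R).
Proof.
move=> eqR; split.
- by move=> [i a]; apply/fiberwiseE; case: (eqR i).
- move=> [i a] [j b] [/= e]; case: _ / e b => b; rewrite tagged_asE => Rab.
  by apply/fiberwiseE; case: (eqR i) => _ + _; apply.
- move=> [i a] [j b] [k c] [/= e]; case: _ / e b => b; rewrite tagged_asE => Rab.
  move=> [/= e]; case: _ / e c => c; rewrite tagged_asE => Rbc.
  by apply/fiberwiseE; case: (eqR i) => _ _ Rt; exact: Rt Rab Rbc.
Qed.

(* The quotients of the library require a choiceType, whose universe is too
   small for a type of structures over finTypes; hence this quotient by
   equivalence classes. *)
Definition quotient (T : Type) (R : T -> T -> Prop) : Type :=
  {C : T -> Prop | exists x, C = R x}.

Definition class (T : Type) (R : T -> T -> Prop) (x : T) : quotient R :=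
  exist _ (R x) (ex_intro _ x erefl).

Lemma quotient_eq (T : Type) (R : T -> T -> Prop) (C D : quotient R) :
  sval C = sval D -> C = D.
Proof. by case: C D => [C hC] [D hD] /= e; case: _ / e hD => hD; congr exist. Qed.

Lemma classP (T : Type) (R : T -> T -> Prop) (C : quotient R) :
  exists x, C = class R x.
Proof. by case: (svalP C) => x Cx; exists x; apply: quotient_eq. Qed.

Lemma eq_class (T : Type) (R : T -> T -> Prop) x y : equivalence R ->
  class R x = class R y <-> R x y.
Proof.
case=> Rr Rs Rt; split=> [/(congr1 sval)/= e | Rxy].
  by apply: (Rs); rewrite -e.
apply: quotient_eq; apply/funext => z; apply/propext.
by split=> [|Ryz]; [apply: Rt; exact: Rs|exact: Rt Rxy Ryz].
Qed.

Section Lift.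
Variables (T U : Type) (R : T -> T -> Prop) (S : U -> U -> Prop) (f : T -> U).
Hypotheses (eqR : equivalence R) (eqS : equivalence S).
Hypothesis fRS : forall x y, R x y -> S (f x) (f y).

Let image (C : T -> Prop) : U -> Prop := fun z => exists2 x, C x & S (f x) z.

Let image_class x : image (R x) = S (f x).
Proof.
case: eqR eqS => Rr Rs Rt [Sr Ss St]; apply/funext => z; apply/propext; split.
  by case=> y /fRS; exact: St.
by exists x.
Qed.

Fact lift_subproof (C : quotient R) : exists y, image (sval C) = S y.
Proof. by case: (svalP C) => x ->; exists (f x); exact: image_class. Qed.

Definition lift_quotient (C : quotient R) : quotient S :=
  exist _ (image (sval C)) (lift_subproof C).

Lemma lift_class x : lift_quotient (class R x) = class S (f x).
Proof. exact/quotient_eq/image_class. Qed.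

End Lift.

Lemma mag_iso_refl p (H : mag p) : mag_iso H H.
Proof.
exists (fun i => id) => [i|u v]; first by exists id.
by rewrite !(_ : forall w, map_vertex (fun i => id) w = w) // => w;
  apply/ffunP => i; rewrite ffunE.
Qed.

Lemma mag_iso_sym p (H K : mag p) : mag_iso H K -> mag_iso K H.
Proof.
case=> F FB FE.
have FG i : exists G, cancel (F i) G /\ cancel G (F i).
  by case: (FB i) => G; exists G.
pose G i := projT1 (cid (FG i)).
have GF i : cancel (F i) (G i) /\ cancel (G i) (F i) by rewrite /G; case: cid.
exists G => [i|u v]; first by exists (F i); case: (GF i).
rewrite FE !(_ : forall w, map_vertex F (map_vertex G w) = w) // => w;
  by apply/ffunP => i; rewrite !ffunE; case: (GF i) => _ ->.
Qed.

Lemma mag_iso_trans p (H K L : mag p) : mag_iso H K -> mag_iso K L -> mag_iso H L.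
Proof.
case=> F FB FE [G GB GE]; exists (fun i => G i \o F i) => [i|u v].
  exact: bij_comp.
rewrite FE GE.
by rewrite !(_ : forall w, map_vertex G (map_vertex F w) =
  map_vertex (fun i => G i \o F i) w) // => w; apply/ffunP => i; rewrite !ffunE.
Qed.

Definition MAG := {p : nat & mag p}.
Definition MAG_iso : MAG -> MAG -> Prop := fiberwise mag_iso.

Lemma MAG_iso_equivalence : equivalence MAG_iso.
Proof.
apply: fiberwise_equivalence => p; split.
- exact: mag_iso_refl.
- exact: mag_iso_sym.
- exact: mag_iso_trans.
Qed.

Section Mixed.
Implicit Types t u v : nat -> nat.

Lemma mixed_lt n t u : (forall i, i < n -> u i < t i) ->
  \sum_(i < n) (\prod_(j < i) t j) * u i < \prod_(i < n) t i.
Proof.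
elim: n => [|n IHn] ut; first by rewrite !big_ord0.
rewrite !big_ord_recr /=.
have lt1 : \sum_(i < n) (\prod_(j < i) t j) * u i < \prod_(i < n) t i.
  by apply: IHn => i /ltnW; exact: ut.
apply: (@leq_trans (\prod_(j < n) t j + (\prod_(j < n) t j) * u n)).
  by rewrite ltn_add2r.
by rewrite -mulnS leq_mul2l ut ?orbT.
Qed.

Lemma mixed_inj n t u v :
  (forall i, i < n -> u i < t i) -> (forall i, i < n -> v i < t i) ->
  \sum_(i < n) (\prod_(j < i) t j) * u i = \sum_(i < n) (\prod_(j < i) t j) * v i ->
  forall i, i < n -> u i = v i.
Proof.
elim: n => [|n IHn] // ut vt; rewrite !big_ord_recr /=.
have ut' i : i < n -> u i < t i by move=> /ltnW; exact: ut.
have vt' i : i < n -> v i < t i by move=> /ltnW; exact: vt.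
have ltu := mixed_lt ut'; have ltv := mixed_lt vt'.
set P := \prod_(j < n) t j in ltu ltv *.
set U := \sum_(i < n) _ in ltu *; set V := \sum_(i < n) _ in ltv *.
have P0 : 0 < P by apply: leq_ltn_trans ltu.
move=> e.
have UV : U = V.
  by move: (congr1 (modn^~ P) e); rewrite !(addnC _ (P * _)) !(mulnC P) !modnMDl !modn_small.
have en : u n = v n.
  by move/eqP: e; rewrite UV eqn_add2l eqn_pmul2l // => /eqP.
by move=> i; rewrite ltnS leq_eqVlt => /predU1P[->//|]; apply: IHn.
Qed.

End Mixed.

Section Numrep.
Variables (p : nat) (tau : p.-tuple nat).

Let ext (u : 'I_p -> nat) (k : nat) := if insub k is Some i then u i else 0.

Let ext_ord u (i : 'I_p) : ext u i = u i.
Proof. by rewrite /ext valK. Qed.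

Let numrep_ext u :
  numrep tau u = (\sum_(i < p) (\prod_(j < i) nth 0 tau j) * ext u i).+1.
Proof.
rewrite /numrep add1n; congr _.+1; apply: eq_bigr => i _; rewrite ext_ord.
congr (_ * _); rewrite (big_ord_widen p (nth 0 tau)) 1?ltnW //.
by apply: eq_bigr => j _; rewrite (tnth_nth 0).
Qed.

Let ext_lt u : (forall i, u i < tnth tau i) ->
  forall k, k < p -> ext u k < nth 0 tau k.
Proof.
by move=> ut k kp; have := ut (Ordinal kp); rewrite -ext_ord (tnth_nth 0).
Qed.

Lemma numrep_le u : (forall i, u i < tnth tau i) -> numrep tau u <= nverts tau.
Proof.
move=> ut; rewrite numrep_ext /nverts.
under [leqRHS]eq_bigr do rewrite (tnth_nth 0).
by apply: mixed_lt; exact: ext_lt.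
Qed.

Lemma numrep_inj u v :
  (forall i, u i < tnth tau i) -> (forall i, v i < tnth tau i) ->
  numrep tau u = numrep tau v -> u =1 v.
Proof.
move=> ut vt; rewrite !numrep_ext => -[e] i; rewrite -(ext_ord u) -(ext_ord v).
exact: (mixed_inj (ext_lt ut) (ext_lt vt) e).
Qed.

Definition numvertex := {dffun forall i : 'I_p, 'I_(tnth tau i)}.

Fact code_subproof (u : numvertex) : (numrep tau (fun i => u i)).-1 < nverts tau.
Proof. by rewrite -add1n /numrep add1n /=; apply: numrep_le => i. Qed.

Definition code (u : numvertex) : 'I_(nverts tau) := Ordinal (code_subproof u).

Lemma codeE (u : numvertex) : numrep tau (fun i => u i) = (code u).+1.
Proof. by []. Qed.

Lemma code_bij : bijective code.
Proof.
apply: inj_card_bij => [u v /(congr1 (fun x : 'I__ => x.+1))|].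
  rewrite -!codeE => /numrep_inj e.
  by apply/ffunP => i; apply/val_inj/e.
rewrite card_dep_ffun card_ord /nverts foldrE big_map big_enum.
by under eq_bigr do rewrite card_ord.
Qed.

End Numrep.

Lemma coords_lt p (H : mag p) (u : vertices (aspect H)) i :
  coords u i < tnth (companion H) i.
Proof. by rewrite tnth_mktuple /coords. Qed.

Lemma coords_inj p (H : mag p) (u v : vertices (aspect H)) :
  numrep (companion H) (coords u) = numrep (companion H) (coords v) -> u = v.
Proof.
move=> /(numrep_inj (coords_lt u) (coords_lt v)) e.
by apply/ffunP => i; apply/enum_rank_inj/val_inj/e.
Qed.

Lemma mag_mxE p (H : mag p) (u v : vertices (aspect H))
    (x y : 'I_(nverts (companion H))) :
  numrep (companion H) (coords u) = x.+1 -> numrep (companion H) (coords v) = y.+1 ->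
  mag_mx H x y = ((u, v) \in edges H).
Proof.
move=> ux vy; rewrite mxE; congr nat_of_bool; apply/exists_inP/idP => [|uv].
  move=> [[a b]] ab /= /andP[/eqP ax /eqP bY]; suff -> : (u, v) = (a, b) by [].
  by congr pair; apply: coords_inj; rewrite ?ux ?vy.
by exists (u, v); rewrite //= ux vy !eqxx.
Qed.

Fact mag_mx_comp_gt0 p (H : mag p) i : 0 < tnth (companion H) i.
Proof. by rewrite tnth_mktuple aspect_gt0. Qed.

Fact mag_mx01 p (H : mag p) x y : mag_mx H x y <= 1.
Proof. by rewrite mxE leq_b1. Qed.

Fact mag_mx_diag p (H : mag p) x : mag_mx H x x = 0.
Proof.
rewrite mxE; case: exists_inP => // -[[a b] /[dup] ab /edges_loopless /=].
by move=> /eqP nab /andP[/eqP ax /eqP bx]; case: nab; apply: coords_inj; rewrite ax bx.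
Qed.

Definition mag_adj p (H : mag p) : adjmx (Tagged (fun p => p.-tuple nat) (companion H)) :=
  @AdjMx (Tagged _ (companion H)) (mag_mx H) 
    (mag_mx_comp_gt0 H) (@mag_mx01 p H) (@mag_mx_diag p H).

Lemma eq_numrep p (tau : p.-tuple nat) u v : u =1 v -> numrep tau u = numrep tau v.
Proof. by move=> uv; congr addn; apply: eq_bigr => i _; rewrite uv. Qed.

Lemma numrep_codeP p (tau : p.-tuple nat) (u : forall i, 'I_(tnth tau i)) :
  {x : 'I_(nverts tau) | numrep tau (fun i => u i) = x.+1}.
Proof.
exists (code [ffun i => u i]); rewrite -codeE.
by apply: eq_numrep => i; rewrite ffunE.
Qed.

Lemma adjmx_sim_refl tau (M : adjmx tau) : adjmx_sim M M.
Proof.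
exists 1%g; last by rewrite row_perm1 col_perm1.
exists (fun i => 1%g) => u x; rewrite perm1 => <-.
by apply: eq_numrep => i; rewrite perm1.
Qed.

Lemma adjmx_sim_sym tau (M N : adjmx tau) : adjmx_sim M N -> adjmx_sim N M.
Proof.
case=> s [g gs] MN; exists s^-1%g; last first.
  by rewrite MN; apply/matrixP => x y; rewrite !mxE !permKV.
exists (fun i => (g i)^-1%g) => u x ux.
have [y uy] := numrep_codeP (fun i => (g i)^-1%g (u i)).
rewrite uy; congr S; congr nat_of_ord; apply: (@perm_inj _ s); rewrite permKV.
apply/val_inj/eq_add_S; rewrite -ux -(gs _ _ uy).
by apply: eq_numrep => i; rewrite permKV.
Qed.

Lemma adjmx_sim_trans tau (M N L : adjmx tau) :
  adjmx_sim M N -> adjmx_sim N L -> adjmx_sim M L.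
Proof.
case=> s [g gs] MN [r [h hr] NL]; exists (s * r)%g; last first.
  by rewrite MN NL; apply/matrixP => x y; rewrite !mxE !permM.
exists (fun i => (g i * h i)%g) => u x ux.
rewrite permM -(hr _ _ (gs _ _ ux)).
by apply: eq_numrep => i; rewrite permM.
Qed.

Definition MatRep := {tau : {p : nat & p.-tuple nat} & adjmx tau}.
Definition MatRep_sim : MatRep -> MatRep -> Prop := fiberwise adjmx_sim.

Lemma MatRep_sim_equivalence : equivalence MatRep_sim.
Proof.
apply: fiberwise_equivalence => tau; split.
- exact: adjmx_sim_refl.
- exact: adjmx_sim_sym.
- exact: adjmx_sim_trans.
Qed.

Local Notation index p tau := (Tagged (fun p => p.-tuple nat) (tau : p.-tuple nat)).

Lemma adjmx_simI p (tau sigma : p.-tuple nat)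
    (M : adjmx (index p tau)) (N : adjmx (index p sigma))
    (g : forall i, 'I_(tnth tau i) -> 'I_(tnth sigma i)) :
  tau = sigma -> (forall i, injective (g i)) ->
  (forall (u v : numvertex tau) (x y : 'I_(nverts tau)) (x' y' : 'I_(nverts sigma)),
    numrep tau (fun i => u i) = x.+1 -> numrep tau (fun i => v i) = y.+1 ->
    numrep sigma (fun i => g i (u i)) = x'.+1 ->
    numrep sigma (fun i => g i (v i)) = y'.+1 ->
    amx M x y = amx N x' y') ->
  fiberwise adjmx_sim (Tagged adjmx M) (Tagged adjmx N).
Proof.
move=> e; case: _ / e N g => N g gI MN; apply/fiberwiseE.
have [dec codeK decK] := code_bij tau.
pose sf x := code [ffun i => g i (dec x i)].
have sI : injective sf.
  move=> x y /(bij_inj (code_bij tau)) /ffunP e; apply: (can_inj decK).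
  by apply/ffunP => i; apply: (gI i); have := e i; rewrite !ffunE.
have sfE (u : forall i, 'I_(tnth tau i)) (x : 'I_(nverts tau)) : numrep tau (fun i => u i) = x.+1 ->
    numrep tau (fun i => g i (u i)) = (sf x).+1.
  move=> ux; rewrite -codeE; apply: eq_numrep => i; rewrite ffunE; congr (_ (g i _)).
  have -> : x = code [ffun i => u i].
    apply/val_inj/eq_add_S; rewrite -ux -codeE.
    by apply: eq_numrep => j; rewrite ffunE.
  by rewrite codeK ffunE.
exists (perm sI).
  exists (fun i => perm (gI i)) => u x /sfE; rewrite permE => <-.
  by apply: eq_numrep => i; rewrite permE.
apply/matrixP => x y; rewrite !mxE !permE.
have decE z : numrep tau (fun i => dec z i) = z.+1 by rewrite codeE decK.
exact: MN (decE x) (decE y) (sfE _ _ (decE x)) (sfE _ _ (decE y)).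
Qed.

Lemma mag_adj_iso p (H K : mag p) : mag_iso H K ->
  fiberwise adjmx_sim (Tagged adjmx (mag_adj H)) (Tagged adjmx (mag_adj K)).
Proof.
case=> F FB FE.
have cardE (L : mag p) i : tnth (companion L) i = #|aspect L i| by rewrite tnth_mktuple.
pose val_ i (k : 'I_(tnth (companion H) i)) : aspect H i :=
  enum_val (cast_ord (cardE H i) k).
pose g i k := cast_ord (esym (cardE K i)) (enum_rank (F i (val_ i k))).
apply: (@adjmx_simI p _ _ _ _ g).
- by apply: eq_from_tnth => i; rewrite !cardE; exact: bij_eq_card (FB i).
- by move=> i k l /cast_ord_inj/enum_rank_inj/(bij_inj (FB i))/enum_val_inj/cast_ord_inj.
move=> u v x y x' y' ux vy ux' vy' /=.
pose a (w : numvertex (companion H)) : vertices (aspect H) := [ffun i => val_ i (w i)].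
have aE w : coords (a w) =1 (fun i => w i).
  by move=> i; rewrite /coords ffunE enum_valK.
have aFE w : coords (map_vertex F (a w)) =1 (fun i => g i (w i)).
  by move=> i; rewrite /coords !ffunE.
rewrite (@mag_mxE _ H (a u) (a v)) ?(eq_numrep _ (aE _)) // FE.
by rewrite -(@mag_mxE _ K _ _ x' y') ?(eq_numrep _ (aFE _)).
Qed.

Definition mat_rep (H : MAG) : MatRep := Tagged adjmx (mag_adj (tagged H)).

Lemma mat_rep_iso (H K : MAG) : MAG_iso H K -> MatRep_sim (mat_rep H) (mat_rep K).
Proof.
case: H K => p H [q K] [/= e]; case: _ / e K => K.
by rewrite tagged_asE; exact: mag_adj_iso.
Qed.

Definition MAG_quot : Type := quotient MAG_iso.
Definition MatRep_quot : Type := quotient MatRep_sim.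

Definition Upsilon : MAG_quot -> MatRep_quot :=
  lift_quotient MAG_iso_equivalence MatRep_sim_equivalence mat_rep_iso.

Lemma Upsilon_class (H : MAG) : Upsilon (class MAG_iso H) = class MatRep_sim (mat_rep H).
Proof. exact: lift_class. Qed.

(* Main.v *)
(* A similarity of matrix representations acts by a bijection of each numerical
   aspect {0, ..., tau_i - 1}; conjugated by the indexings of the aspects, these
   bijections form an aspect list bijection, which preserves edges since the
   matrix entries record adjacency.  Hence Upsilon is injective and F factors
   through it. *)
Require Import Defs.
From mathcomp Require Import all_boot perm matrix boolp.

Set Implicit Arguments.
Unset Strict Implicit.
Unset Printing Implicit Defensive.

(** Converse of [adjmx_simI]. Keeping [tau] and [sigma] as separate variables lets their equality be
    eliminated here; the companion tuples of two MAGs are only provably equal. *)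
Lemma adjmx_simE p (tau sigma : p.-tuple nat)
    (M : adjmx (Tagged (fun p => p.-tuple nat) tau))
    (N : adjmx (Tagged (fun p => p.-tuple nat) sigma)) :
  fiberwise adjmx_sim (Tagged adjmx M) (Tagged adjmx N) ->
  exists2 g : forall i, 'I_(tnth tau i) -> 'I_(tnth sigma i),
    forall i, bijective (g i) &
    forall (u v : forall i, 'I_(tnth tau i))
        (x y : 'I_(nverts tau)) (x' y' : 'I_(nverts sigma)),
      numrep tau (fun i => u i) = x.+1 -> numrep tau (fun i => v i) = y.+1 ->
      numrep sigma (fun i => g i (u i)) = x'.+1 ->
      numrep sigma (fun i => g i (v i)) = y'.+1 ->
      amx M x y = amx N x' y'.
Proof.
move=> MN; have e : tau = sigma.
  (* Decidable equality of the indices [p] extracts the second components from an equality of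
     dependent pairs. *)
  by case: MN => /eqP + _; rewrite -tag_eqE /tag_eq /= eqxx tagged_asE => /eqP.
case: _ / e N MN => N /fiberwiseE[s [g gs] ->].
exists (fun i => g i) => [i|u v x y x' y' ux vy]; first exact: injF_bij perm_inj.
rewrite (gs _ _ ux) (gs _ _ vy) => -[/val_inj <-] [/val_inj <-].
by rewrite !mxE.
Qed.

Lemma mag_adj_sim p (H K : mag p) :
  fiberwise adjmx_sim (Tagged adjmx (mag_adj H)) (Tagged adjmx (mag_adj K)) ->
  mag_iso H K.
Proof.
move=> /adjmx_simE[g gB gE].
have cardE (L : mag p) i : #|aspect L i| = tnth (companion L) i.
  by rewrite tnth_mktuple.
pose rank (L : mag p) i (a : aspect L i) := cast_ord (cardE L i) (enum_rank a).
pose unrank (L : mag p) i k : aspect L i := enum_val (cast_ord (esym (cardE L i)) k).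
have rankK L i : cancel (@rank L i) (unrank L i).
  by move=> a; rewrite /unrank cast_ordK enum_rankK.
have unrankK L i : cancel (unrank L i) (@rank L i).
  by move=> k; rewrite /rank enum_valK cast_ordKV.
pose F i a := unrank K i (g i (rank H i a)).
exists F => [i|u v].
  apply: (bij_comp (f := unrank K i)); first by exists (@rank K i).
  by apply: bij_comp (gB i) _; exists (unrank H i).
(* [F] acts on coordinates as [g], so [ux'] and [vy'] locate the images of [u] and [v] in the matrix
   of [K]. *)
have FE (w : vertices (aspect H)) :
    (fun i => g i (rank H i (w i)) : nat) =1 coords (map_vertex F w).
  by move=> i; rewrite /coords ffunE -[RHS]/(val (rank K i (F i (w i)))) unrankK.
have [x ux] := numrep_codeP (fun i => rank H i (u i)).
have [y vy] := numrep_codeP (fun i => rank H i (v i)).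
have [x' ux'] := numrep_codeP (fun i => g i (rank H i (u i))).
have [y' vy'] := numrep_codeP (fun i => g i (rank H i (v i))).
have /= := gE _ _ _ _ _ _ ux vy ux' vy'.
rewrite (mag_mxE (u := u) (v := v) ux vy).
rewrite (eq_numrep _ (FE u)) in ux'; rewrite (eq_numrep _ (FE v)) in vy'.
by rewrite (mag_mxE ux' vy'); do 2!case: (_ \in _).
Qed.

Lemma mat_rep_sim (H K : MAG) : MatRep_sim (mat_rep H) (mat_rep K) -> MAG_iso H K.
Proof.
case: H K => p H [q K] HK.
have e : p = q := congr1 tag HK.1.
by case: _ / e K HK => K /mag_adj_sim; rewrite -fiberwiseE.
Qed.

Lemma Upsilon_inj : injective Upsilon.
Proof.
move=> C D; have [[H ->] [K ->]] := (classP C, classP D).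
rewrite !Upsilon_class => /(eq_class _ _ MatRep_sim_equivalence)/mat_rep_sim.
by move/(eq_class _ _ MAG_iso_equivalence).
Qed.

(** Provides a default off the image of [Upsilon]: as [X] is arbitrary, a value in it has to come
    from [F]. In order 0 the condition on aspects is vacuous. *)
Lemma MAG_inhabited : inhabited MAG.
Proof.
by constructor; exists 0, (fun=> unit) set0 => [[]|e] //; rewrite in_set0.
Qed.

Theorem theorem2 (X : Type) (F : MAG_quot -> X) :
  exists Fhat : MatRep_quot -> X, forall H : MAG_quot, Fhat (Upsilon H) = F H.
Proof.
have [H0] := MAG_inhabited.
(* Guarding the equation by an implication makes a witness exist for every [D], so that [cid] yields
   a total choice. *)
have preim D : exists C, (exists C', Upsilon C' = D) -> Upsilon C = D.
  have [[C CD]|nD] := pselect (exists C', Upsilon C' = D); first by exists C.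
  by exists (class MAG_iso H0).
exists (fun D => F (projT1 (cid (preim D)))) => H.
by congr F; case: cid => C /= CH; apply/Upsilon_inj/CH; exists H.
Qed.
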